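(* Consider, for each $n$, the fixed-design linear model $Y_i=\mathbf{X}_i'\boldsymbol{\beta}+\varepsilon_i$, $i=1,\dots,n$, with $p_n$ covariates of which the first $k_n$ have nonzero coefficients and the others have zero coefficients, and let $\widehat{\boldsymbol{\beta}}_n$ be the LS-SCAD estimator with penalty parameters $\lambda_n>0$ and $a>2$ (all as set out in the context). Suppose that: (i) the $\varepsilon_i$ are i.i.d. with mean $0$ and variance $\sigma^2$; (ii) for every $j\in\{1,\dots,p_n\}$ the $j$-th column $\mathbb{X}_{\cdot j}$ of $\mathbb{X}$ satisfies $\|\mathbb{X}_{\cdot j}\|^2=n$; (iii) $\lim_{n\to\infty}\sqrt{k_n}\,\lambda_n/\sqrt{\rho_{n,1}}=0$; (iv) $\lim_{n\to\infty}\sqrt{p_n}/\sqrt{n\rho_{n,1}}=0$, where $\rho_{n,1}$ is the smallest eigenvalue of $n^{-1}\mathbb{X}'\mathbb{X}$. Then $\|\widehat{\boldsymbol{\beta}}_n-\boldsymbol{\beta}\|\to 0$ in probability as $n\to\infty$.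
   Context: Setting. For each $n$, observations $(\mathbf{X}_i,Y_i)$, $i=1,\dots,n$, satisfy $Y_i=\mathbf{X}_i'\boldsymbol{\beta}+\varepsilon_i$ (the intercept is taken to be $0$), where $\mathbf{X}_i=(X_{i1},\dots,X_{ip_n})'$ is a $p_n\times1$ vector, $\varepsilon_i$ is a random error, and $\boldsymbol{\beta}=(\beta_1,\dots,\beta_{p_n})'\in\mathbb{R}^{p_n}$. The covariates $X_{ij}$ and parameters $p_n,k_n,\boldsymbol{\beta},\lambda_n$ may depend on $n$; $a>2$ and $\sigma^2$ are fixed, and the error distribution does not change with $n$. In the fixed design setting the $X_{ij}$ are nonrandom. Write $\boldsymbol{\beta}=(\boldsymbol{\beta}_1',\boldsymbol{\beta}_2')'$ with $\boldsymbol{\beta}_1=(\beta_1,\dots,\beta_{k_n})'$ having all components nonzero and $\boldsymbol{\beta}_2=\mathbf{0}_{m_n}$, $m_n=p_n-k_n$. Let $\mathbf{Y}=(Y_1,\dots,Y_n)'$ and let $\mathbb{X}=(X_{ij})$ be the $n\times p_n$ design matrix. $\|\cdot\|$ is the Euclidean norm. Conditions with $\rho_{n,1}$ in a denominator are understood with $\rho_{n,1}>0$. SCAD penalty. For $a>2$, $\lambda>0$: $p_\lambda(\theta;a)=\lambda|\theta|$ if $|\theta|\le\lambda$; $p_\lambda(\theta;a)=-(\theta^2-2a\lambda|\theta|+\lambda^2)/[2(a-1)]$ if $\lambda<|\theta|\le a\lambda$; $p_\lambda(\theta;a)=(a+1)\lambda^2/2$ if $|\theta|>a\lambda$. LS-SCAD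 estimator. $\widehat{\boldsymbol{\beta}}_n=\arg\min_{\mathbf{b}\in\mathbb{R}^{p_n}}Q_n(\mathbf{b};\lambda_n,a)$, where $Q_n(\mathbf{b};\lambda_n,a)=\|\mathbf{Y}-\mathbb{X}\mathbf{b}\|^2+n\sum_{j=1}^{p_n}p_{\lambda_n}(b_j;a)$ (a global minimizer). *)

(* Defs.v *)
From HB Require Import structures.
From mathcomp Require Export all_boot all_order all_algebra.
From mathcomp Require Export all_classical all_reals all_analysis.
Export Order.TTheory GRing.Theory Num.Theory.
Export numFieldNormedType.Exports.

Set Implicit Arguments.
Unset Strict Implicit.
Unset Printing Implicit Defensive.

Local Open Scope classical_set_scope.
Local Open Scope ring_scope.

(* The library norm on matrices is the sup norm, hence this definition. *)
Definition norm2 (R : realType) (m : nat) (v : 'cV[R]_m) : R :=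
  Num.sqrt (\sum_(i < m) v i 0 ^+ 2).

Definition scad (R : realType) (lambda a theta : R) : R :=
  if `|theta| <= lambda then lambda * `|theta|
  else if `|theta| <= a * lambda then
    - (theta ^+ 2 - 2 * a * lambda * `|theta| + lambda ^+ 2) / (2 * (a - 1))
  else (a + 1) * lambda ^+ 2 / 2.

Definition scad_objective (R : realType) (n p : nat) (X : 'M[R]_(n, p))
    (y : 'cV[R]_n) (lambda a : R) (b : 'cV[R]_p) : R :=
  norm2 (y - X *m b) ^+ 2 + n%:R * \sum_(j < p) scad lambda a (b j 0).

(* The objective is not convex, so its global minimizer need not be unique:
   being an LS-SCAD estimate is a predicate. *)
Definition ls_scad (R : realType) (n p : nat) (X : 'M[R]_(n, p))
    (y : 'cV[R]_n) (lambda a : R) (bhat : 'cV[R]_p) : Prop :=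
  forall b : 'cV[R]_p,
    scad_objective X y lambda a bhat <= scad_objective X y lambda a b.

Definition gram (R : realType) (n p : nat) (X : 'M[R]_(n, p)) : 'M[R]_p :=
  n%:R^-1 *: (X^T *m X).

(* A 0 x 0 matrix has no eigenvalue, hence no smallest one. *)
Definition smallest_eigenvalue (R : realType) (p : nat) (A : 'M[R]_p)
    (rho : R) : Prop :=
  eigenvalue A rho /\ forall mu : R, eigenvalue A mu -> rho <= mu.

Definition mutually_independent (R : realType) (d : measure_display)
    (T : measurableType d) (P : probability T R) (n : nat)
    (Z : 'I_n -> {RV P >-> R}) : Prop :=
  forall (J : {set 'I_n}) (A : 'I_n -> set R),
    (forall i, measurable (A i)) ->
    P (\bigcap_(i in [set` J]) (Z i @^-1` A i)) =
    (\prod_(i in J) P (Z i @^-1` A i))%E.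

(* Laws are compared on measurable sets only: a measure takes arbitrary values
   on the other sets. *)
Definition has_law (R : realType) (d : measure_display)
    (T : measurableType d) (P : probability T R) (Z : {RV P >-> R})
    (mu : probability (measurableTypeR R) R) : Prop :=
  forall A : set R, measurable A -> distribution P Z A = mu A.

Definition random_vector (R : realType) (d : measure_display)
    (T : measurableType d) (m : nat) (V : T -> 'cV[R]_m) : Prop :=
  forall j : 'I_m, measurable_fun [set: T] (fun w => V w j 0).

(* The probability space is allowed to vary along the sequence, as is usual for
   triangular arrays; this makes sense because the limit is a constant. *)
Definition cvg_in_probability (R : realType) (d : nat -> measure_display)
    (T : forall n, measurableType (d n)) (P : forall n, probability (T n) R)
    (Z : forall n, T n -> R) (c : R) : Prop :=
  forall e : R, 0 < e ->
    (fun n => P n [set w | e < `|Z n w - c|]) @ \oo --> 0%E.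

(* Main.v *)
Require Import Defs.
From mathcomp Require Import measurable_realfun ring lra.

(* Put u = bhat - beta, and let H be the orthogonal projection onto the column
   space of X. Comparing the objective at bhat and at beta, and bounding the
   penalty of beta by k (a + 1) lambda^2 / 2, gives
     |X u|^2 <= 2 <eps, X u> + n k (a + 1) lambda^2 / 2.
   Since <eps, X u> = <H eps, X u> and |X u|^2 >= n rho |u|^2, it follows that
     |u|^2 <= 4 |H eps|^2 / (n rho) + (a + 1) k lambda^2 / rho.
   The last term tends to 0, and E |H eps|^2 = sigma^2 tr H = sigma^2 p, so
   Markov's inequality concludes. *)

Set Implicit Arguments.
Unset Strict Implicit.
Unset Printing Implicit Defensive.

Local Open Scope classical_set_scope.
Local Open Scope ring_scope.

(** * Quadratic forms and the smallest eigenvalue of a symmetric matrix *)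

Section Rayleigh.
Context {R : realType}.

Definition dotmx (m : nat) (x y : 'cV[R]_m) : R := (x^T *m y) 0 0.

Lemma dotmxE m (x y : 'cV[R]_m) : dotmx x y = \sum_i x i 0 * y i 0.
Proof. by rewrite /dotmx mxE; apply: eq_bigr => i _; rewrite mxE. Qed.

Lemma norm2_sqr m (x : 'cV[R]_m) : norm2 x ^+ 2 = dotmx x x.
Proof.
rewrite dotmxE /norm2 sqr_sqrtr; last by apply: sumr_ge0 => i _; exact: sqr_ge0.
by apply: eq_bigr => i _; rewrite expr2.
Qed.

Lemma dotmx_ge0 m (x : 'cV[R]_m) : 0 <= dotmx x x.
Proof. by rewrite -norm2_sqr sqr_ge0. Qed.

Lemma dotmx_gt0 m (x : 'cV[R]_m) : x != 0 -> 0 < dotmx x x.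
Proof.
move=> x0; rewrite lt_def dotmx_ge0 andbT; apply: contra x0.
rewrite dotmxE psumr_eq0 => [/allP h|i _]; last by rewrite -expr2 sqr_ge0.
apply/eqP/colP => i; rewrite mxE; apply/eqP.
by have := h i (mem_index_enum i); rewrite mulf_eq0 orbb.
Qed.

Lemma dotmxC m (x y : 'cV[R]_m) : dotmx x y = dotmx y x.
Proof. by rewrite !dotmxE; apply: eq_bigr => i _; rewrite mulrC. Qed.

Lemma dotmxDr m (x y z : 'cV[R]_m) : dotmx x (y + z) = dotmx x y + dotmx x z.
Proof. by rewrite /dotmx mulmxDr mxE. Qed.

Lemma dotmxDl m (x y z : 'cV[R]_m) : dotmx (x + y) z = dotmx x z + dotmx y z.
Proof. by rewrite dotmxC dotmxDr !(dotmxC z). Qed.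

Lemma dotmxZr m (a : R) (x y : 'cV[R]_m) : dotmx x (a *: y) = a * dotmx x y.
Proof. by rewrite /dotmx -scalemxAr mxE. Qed.

Lemma dotmxZl m (a : R) (x y : 'cV[R]_m) : dotmx (a *: x) y = a * dotmx x y.
Proof. by rewrite dotmxC dotmxZr dotmxC. Qed.

Lemma dotmxBr m (x y z : 'cV[R]_m) : dotmx x (y - z) = dotmx x y - dotmx x z.
Proof. by rewrite dotmxDr -scaleN1r dotmxZr mulN1r. Qed.

Lemma dotmxBl m (x y z : 'cV[R]_m) : dotmx (x - y) z = dotmx x z - dotmx y z.
Proof. by rewrite dotmxC dotmxBr !(dotmxC z). Qed.

Lemma dotmx_mull m q (A : 'M[R]_(m, q)) x y :
  dotmx (A *m x) y = dotmx x (A^T *m y).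
Proof. by rewrite /dotmx trmx_mul mulmxA. Qed.

Lemma quadratic_formE m (A : 'M[R]_m) (x : 'cV[R]_m) :
  dotmx x (A *m x) = \sum_i \sum_j A i j * (x i 0 * x j 0).
Proof.
rewrite dotmxE; apply: eq_bigr => i _; rewrite mxE mulr_sumr.
by apply: eq_bigr => j _; ring.
Qed.

(** Each product [x i 0 * x j 0] is at most |x|^2 in absolute value, so the sum of the [|A i j|]
    bounds the form; adding 1 keeps [K] positive when [A] is zero. *)
Lemma quadratic_form_le m (A : 'M[R]_m) :
  exists2 K, 0 < K & forall x, dotmx x (A *m x) <= K * dotmx x x.
Proof.
exists (1 + \sum_i \sum_j `|A i j|).
  by rewrite ltr_pwDl// !sumr_ge0// => i _; rewrite sumr_ge0.
move=> x; rewrite mulrDl mul1r quadratic_formE.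
apply: ler_wpDl; first exact: dotmx_ge0.
rewrite mulr_suml; apply: ler_sum => i _.
rewrite mulr_suml; apply: ler_sum => j _.
rewrite (le_trans (ler_norm _))// normrM ler_wpM2l//.
have sq k : x k 0 ^+ 2 <= dotmx x x.
  rewrite dotmxE (bigD1 k)//= -expr2 lerDl sumr_ge0// => l _.
  by rewrite -expr2 sqr_ge0.
rewrite ler_norml; apply/andP; split; move: (sq i) (sq j); nra.
Qed.

(* Expanding the form at [x - s A^-1 x] gives
   [2 s |x|^2 - s^2 <x, A^-1 x> <= <x, A x>]. *)
Lemma psd_unit_coercive m (A : 'M[R]_m) : A^T = A -> A \in unitmx ->
    (forall x, 0 <= dotmx x (A *m x)) ->
  exists2 c, 0 < c & forall x, c * dotmx x x <= dotmx x (A *m x).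
Proof.
move=> symA uA psdA; have [K K0 hK] := quadratic_form_le (invmx A).
(* With s = [K^-1] the subtracted term s^2 <x, A^-1 x> is at most s |x|^2, which leaves s |x|^2 as
   the lower bound. *)
exists K^-1 => [|x]; first by rewrite invr_gt0.
have := psdA (x - K^-1 *: (invmx A *m x)).
rewrite mulmxBr -scalemxAr mulKVmx// dotmxBl !dotmxBr !dotmxZl !dotmxZr.
rewrite dotmx_mull mulmxA trmx_inv symA mulVmx// mul1mx.
rewrite (dotmxC (invmx A *m x)).
have hx' : K^-1 * dotmx x (invmx A *m x) <= dotmx x x.
  by rewrite ler_pdivrMl// hK.
have Ki : 0 < K^-1 by rewrite invr_gt0.
nra.
Qed.

Lemma eigenvalueN_unit (F : fieldType) m (A : 'M[F]_m) t :
  ~~ eigenvalue A t -> A - t%:M \in unitmx.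
Proof.
by rewrite /eigenvalue /eigenspace negbK kermx_eq0 row_free_unit.
Qed.

(** Let s be the largest t with t |x|^2 <= <x, A x> for all x. If s were not an eigenvalue, A - s I
    would be invertible and positive semidefinite, hence coercive, and s could be increased. So s is
    an eigenvalue and [rho] <= s. *)
Lemma smallest_eigenvalue_quadratic_form m (A : 'M[R]_m) rho :
    A^T = A -> smallest_eigenvalue A rho ->
  forall x, rho * dotmx x x <= dotmx x (A *m x).
Proof.
move=> symA [/eigenvalueP[v vA v0] rho_min].
pose S := [set t | forall x, t * dotmx x x <= dotmx x (A *m x)].
(* Eigenvectors are row vectors, so the form is tested at [v^T]; symmetry of [A] turns the left
   eigenvector into a right one. *)
have ubS : ubound S rho.
  move=> t /(_ v^T); rewrite -symA -trmx_mul vA linearZ dotmxZr ler_pM2r//.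
  by rewrite dotmx_gt0// trmx_eq0.
have [K _ hK] := quadratic_form_le (- A).
have SK : S (- K).
  by move=> x; move: (hK x); rewrite mulNmx -scaleN1r dotmxZr mulN1r mulNr lerNl.
have hS : has_sup S by split; [exists (- K) | exists rho].
(* The supremum is attained: for nonzero [x] every member of [S] is at most the Rayleigh quotient of
   [x], hence so is [sup S]. *)
have supS : S (sup S).
  move=> x; have [->|x0] := eqVneq x 0.
    by have := SK 0; rewrite !dotmxE !big1 ?mulr0// => i _; rewrite mxE mul0r.
  rewrite -ler_pdivlMr ?dotmx_gt0//; apply: ge_sup; first exact: hS.1.
  by move=> t St; rewrite ler_pdivlMr ?dotmx_gt0.
suff /rho_min rho_le : eigenvalue A (sup S).
  move=> x; apply: le_trans (supS x).
  by rewrite ler_wpM2r ?dotmx_ge0.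
apply: contraT => /eigenvalueN_unit uB.
have [||c c0 hc] := psd_unit_coercive _ uB.
- by rewrite linearB/= symA tr_scalar_mx.
- by move=> x; rewrite mulmxBl mul_scalar_mx dotmxBr dotmxZr subr_ge0.
have : S (sup S + c).
  move=> x; move: (hc x); rewrite mulmxBl mul_scalar_mx dotmxBr dotmxZr.
  by rewrite mulrDl; lra.
by move=> /(ub_le_sup hS.2); rewrite gerDl leNgt c0.
Qed.

End Rayleigh.

(** * Bounds on the SCAD penalty *)

Section Deterministic.
Context {R : realType}.

Lemma scad_ge0 (lambda a t : R) : 0 < lambda -> 2 < a -> 0 <= scad lambda a t.
Proof.
move=> l0 a2; rewrite /scad; case: ifP => [_|/negbT].
  by rewrite mulr_ge0// ltW.
rewrite -ltNge => lt; case: ifP => [ta|_]; last first.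
  by rewrite divr_ge0// mulr_ge0 ?sqr_ge0//; lra.
rewrite -real_normK ?num_real// divr_ge0//; last by lra.
nra.
Qed.

(** On the middle range the gap to the plateau value is (|t| - a lambda)^2 / (2 (a - 1)), which is
    nonnegative. *)
Lemma scad_le (lambda a t : R) : 0 < lambda -> 2 < a ->
  scad lambda a t <= (a + 1) * lambda ^+ 2 / 2.
Proof.
move=> l0 a2; rewrite /scad; case: ifP => [tl|/negbT].
  have := normr_ge0 t; nra.
rewrite -ltNge => lt; case: ifP => [ta|//].
rewrite -real_normK ?num_real// ler_pdivrMr; last by lra.
have : 0 <= (`|t| - a * lambda) ^+ 2 by exact: sqr_ge0.
nra.
Qed.

Lemma scad0 (lambda a : R) : 0 < lambda -> scad lambda a 0 = 0.
Proof. by move=> l0; rewrite /scad normr0 ltW// mulr0. Qed.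

Lemma sum_scad_sparse_le p k (lambda a : R) (b : 'cV[R]_p) :
    0 < lambda -> 2 < a -> (forall j : 'I_p, (k <= j)%N -> b j 0 = 0) ->
  \sum_(j < p) scad lambda a (b j 0) <= k%:R * ((a + 1) * lambda ^+ 2 / 2).
Proof.
move=> l0 a2 b0; set c := _ / 2.
have c0 : 0 <= c by rewrite divr_ge0// mulr_ge0 ?sqr_ge0//; lra.
rewrite (bigID (fun j : 'I_p => (j < k)%N))/= [X in _ + X]big1 ?addr0; last first.
  by move=> j; rewrite -leqNgt => /b0 ->; rewrite scad0.
apply: (@le_trans _ _ (\sum_(j < p | (j < k)%N) c)).
  by apply: ler_sum => j _; exact: scad_le.
rewrite sumr_const -[leLHS]mulr_natl ler_wpM2r// ler_nat.
(* At most [k] indices lie below both [k] and [p]: they form a duplicate-free list contained in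
   [iota 0 k]. *)
rewrite -sum1_card -(big_mkord (fun j => j < k)%N (fun=> 1%N)).
rewrite -big_filter sum1_size -[leqRHS](size_iota 0).
apply: uniq_leq_size; first by rewrite filter_uniq ?iota_uniq.
by move=> j; rewrite mem_filter mem_iota => /andP[-> _].
Qed.

(** * Projection onto the column space, and the deterministic error bound *)

Lemma tr_gram n p (X : 'M[R]_(n, p)) : (gram X)^T = gram X.
Proof. by rewrite /gram linearZ/= trmx_mul trmxK. Qed.

(** The least-squares hat matrix X (X'X)^-1 X' when [gram X] is invertible; the factor [n%:R^-1]
    offsets the normalisation in [gram]. *)
Definition hat_mx n p (X : 'M[R]_(n, p)) : 'M[R]_n :=
  n%:R^-1 *: (X *m invmx (gram X) *m X^T).

Lemma tr_hat_mx n p (X : 'M[R]_(n, p)) : (hat_mx X)^T = hat_mx X.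
Proof.
by rewrite /hat_mx linearZ/= !trmx_mul trmxK trmx_inv tr_gram mulmxA.
Qed.

Lemma hat_mxK n p (X : 'M[R]_(n, p)) : gram X \in unitmx -> hat_mx X *m X = X.
Proof.
move=> uG; rewrite /hat_mx -scalemxAl -mulmxA scalemxAr -/(gram X).
by rewrite -mulmxA mulVmx// mulmx1.
Qed.

Lemma hat_mx_idem n p (X : 'M[R]_(n, p)) : gram X \in unitmx ->
  hat_mx X *m hat_mx X = hat_mx X.
Proof.
by move=> uG; rewrite {2}/hat_mx -scalemxAr !mulmxA hat_mxK.
Qed.

(** Cyclicity of the trace reduces the product to the identity of size [p]. *)
Lemma mxtrace_hat_mx n p (X : 'M[R]_(n, p)) : gram X \in unitmx ->
  \tr (hat_mx X) = p%:R.
Proof.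
move=> uG; rewrite /hat_mx -mulmxA scalemxAr mxtrace_mulC -scalemxAl -mulmxA.
by rewrite scalemxAr -/(gram X) mulVmx// mxtrace1.
Qed.

(** Since H is symmetric and idempotent, <e, H e> = |H e|^2; this quadratic form is how |H e|^2 is
    written from here on. *)
Lemma dotmx_hat_mx_ge0 n p (X : 'M[R]_(n, p)) (e : 'cV[R]_n) :
  gram X \in unitmx -> 0 <= dotmx e (hat_mx X *m e).
Proof.
move=> uG; rewrite -hat_mx_idem// -mulmxA -{1}(tr_hat_mx X) -dotmx_mull.
exact: dotmx_ge0.
Qed.

(** H fixes X u, so <e, X u> = <H e, X u>; then expand |2 H e - X u|^2 >= 0. The weight 1/2 lets
    half of |X u|^2 be absorbed later. *)
Lemma dotmx_mulmx_hat_le n p (X : 'M[R]_(n, p)) (e : 'cV[R]_n) (u : 'cV[R]_p) :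
    gram X \in unitmx ->
  2 * dotmx e (X *m u) <=
    2 * dotmx e (hat_mx X *m e) + dotmx (X *m u) (X *m u) / 2.
Proof.
move=> uG.
have XuE : dotmx e (X *m u) = dotmx (hat_mx X *m e) (X *m u).
  by rewrite dotmx_mull tr_hat_mx mulmxA hat_mxK.
have eHe : dotmx e (hat_mx X *m e) = dotmx (hat_mx X *m e) (hat_mx X *m e).
  by rewrite dotmx_mull tr_hat_mx mulmxA hat_mx_idem.
have := dotmx_ge0 (2 *: (hat_mx X *m e) - X *m u).
rewrite dotmxBl !dotmxBr !dotmxZl !dotmxZr (dotmxC (X *m u) (hat_mx X *m e)).
rewrite -XuE -eHe; lra.
Qed.

Lemma smallest_eigenvalue_gt0_unit p (A : 'M[R]_p) rho :
  smallest_eigenvalue A rho -> 0 < rho -> A \in unitmx.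
Proof.
move=> [_ rho_min] rho0; rewrite -(subr0 A) -(scale0r 1%:M) scalemx1.
apply: eigenvalueN_unit; apply: contraTN rho0 => /rho_min.
by rewrite -leNgt.
Qed.

Lemma ls_scad_error_le n p k (X : 'M[R]_(n, p)) (y e : 'cV[R]_n)
    (beta bhat : 'cV[R]_p) (lambda a rho : R) :
    (0 < n)%N -> 0 < lambda -> 2 < a ->
    (forall j : 'I_p, (k <= j)%N -> beta j 0 = 0) ->
    smallest_eigenvalue (gram X) rho -> 0 < rho ->
    y = X *m beta + e -> ls_scad X y lambda a bhat ->
  norm2 (bhat - beta) ^+ 2 <= 4 / (n%:R * rho) * dotmx e (hat_mx X *m e) +
    (a + 1) * (k%:R * lambda ^+ 2 / rho).
Proof.
move=> n0 l0 a2 beta0 srho rho0 ->.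
have uG := smallest_eigenvalue_gt0_unit srho rho0.
have [u uE] : exists u, u = bhat - beta by eexists.
have nR : 0 < n%:R :> R by rewrite ltr0n.
(* The residual is [e - X *m u] at [bhat] and [e] at [beta], so |e|^2 cancels from the
   comparison. *)
move=> /(_ beta); rewrite /scad_objective [X in norm2 X](_ : _ = e - X *m u); last first.
  by rewrite uE mulmxBr opprB addrCA -addrA addrC.
rewrite [X in _ <= norm2 X ^+ _ + _](_ : _ = e); last by rewrite addrC addKr.
rewrite -uE !norm2_sqr dotmxBl !dotmxBr (dotmxC (X *m u) e).
have pen_hat : 0 <= n%:R * \sum_(j < p) scad lambda a (bhat j 0).
  by rewrite mulr_ge0 ?ler0n// sumr_ge0// => j _; exact: scad_ge0.
have pen := ler_wpM2l (ltW nR) (sum_scad_sparse_le l0 a2 beta0).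
have Xu := dotmx_mulmx_hat_le e u uG.
have Xu_ge : n%:R * rho * dotmx u u <= dotmx (X *m u) (X *m u).
  have := smallest_eigenvalue_quadratic_form (tr_gram X) srho u.
  by rewrite /gram -scalemxAl dotmxZr -mulmxA -dotmx_mull ler_pdivlMl ?mulrA.
(* Absorbing |X u|^2 / 2 gives |X u|^2 <= 4 <e, H e> + n k (a + 1) lambda^2, and the left side is at
   least n rho |u|^2. *)
move=> opt; rewrite -(ler_pM2l (mulr_gt0 nR rho0)).
have -> : n%:R * rho * (4 / (n%:R * rho) * dotmx e (hat_mx X *m e) +
    (a + 1) * (k%:R * lambda ^+ 2 / rho)) =
  4 * dotmx e (hat_mx X *m e) + 2 * (n%:R * (k%:R * ((a + 1) * lambda ^+ 2 / 2))).
  by field; rewrite !gt_eqF.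
lra.
Qed.

End Deterministic.

(** * Expectation of a quadratic form in independent centred errors *)

Section Moments.
Context {R : realType} {d : measure_display} {T : measurableType d}.
Variable P : probability T R.
Local Open Scope ereal_scope.

(** Independence identifies the joint law with the product of the marginal laws, and Fubini's
    theorem then factors the integral of the product. *)
Lemma expectationM_indep (X Y : {RV P >-> R}) :
    (forall A B, measurable A -> measurable B ->
      P (X @^-1` A `&` Y @^-1` B) = P (X @^-1` A) * P (Y @^-1` B)) ->
    (X : T -> R) \in Lfun P 1 -> (Y : T -> R) \in Lfun P 1 ->
    (X \* Y)%R \in Lfun P 1 ->
  'E_P[X \* Y] = 'E_P[X] * 'E_P[Y].
Proof.
move=> XY_indep /Lfun1_integrable iX /Lfun1_integrable iY /Lfun1_integrable iXY.
pose XY : T -> (R * R)%type := fun w => (X w, Y w).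
have mXY : measurable_fun setT XY by apply: measurable_fun_pair.
pose m := distribution P X; pose m' := distribution P Y.
pose f : (R * R)%type -> \bar R := fun z => (z.1 * z.2)%:E.
have mf : measurable_fun [set: (R * R)%type] f.
  by apply/measurable_EFinP; apply: measurable_funM.
(* The two measures agree on measurable rectangles, which determine the product measure. *)
have joint A : measurable A -> (m \x m') A = pushforward P XY A.
  by apply: (@product_measure_unique _ _ _ _ _ m m' (pushforward P XY)) => B C mB mC; exact: XY_indep.
have if_joint : (pushforward P XY).-integrable [set: (R * R)%type] f.
  exact: integrable_pushforward.
have if_prod : (m \x m').-integrable [set: (R * R)%type] f.
  apply/integrableP; split => //.
  rewrite (eq_measure_integral (pushforward P XY)) => [|A mA _]; last exact: joint.
  by move/integrableP : if_joint => [].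
rewrite unlock.
transitivity (\int[pushforward P XY]_z f z).
  by rewrite integral_pushforward.
rewrite (eq_measure_integral (m \x m')) => [|A mA _]; last exact/esym/joint.
rewrite -integral12_prod_meas1// /fubini_F.
have iY' : m'.-integrable setT EFin by exact: integrable_pushforward.
have iX' : m.-integrable setT EFin by exact: integrable_pushforward.
rewrite -[X in _ * X](@integral_distribution _ _ _ _ _ P Y EFin)//.
rewrite -[X in X * _](@integral_distribution _ _ _ _ _ P X EFin)//.
transitivity (\int[m]_x (x%:E * \int[m']_y y%:E)).
  by apply: eq_integral => x _; rewrite -integralZl.
by rewrite -(fineK (integrable_fin_num measurableT iY')) integralZr.
Qed.

(** For a centred variable the variance is the integral of its square, so a finite variance is
    square integrability. *)
Lemma variance_fin_Lfun2 (X : {RV P >-> R}) :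
  'V_P[X] \is a fin_num -> 'E_P[X] = 0 -> (X : T -> R) \in Lfun P 2%:E.
Proof.
rewrite /variance covariance.unlock => /[swap] -> /= VX.
rewrite inE; apply/andP; split; rewrite inE//=.
rewrite /finite_norm unlock/= poweR_lty//.
move: VX; rewrite unlock => /fin_numPlt/andP[_]; apply: le_lt_trans.
have sqE w : (((X \- cst 0) * (X \- cst 0)) w = X w ^+ 2)%R.
  by rewrite !fctE/= subr0 -expr2.
have normE w : ((`|X w| `^ 2)%R = X w ^+ 2)%R.
  by rewrite powR_mulrn// real_normK ?num_real.
under eq_integral do rewrite normE.
under [leRHS]eq_integral do rewrite sqE.
by [].
Qed.

(** By linearity only the diagonal survives: off-diagonal products have mean 0 and squares have mean
    [sigma2]. *)
Lemma expectation_quadratic_form n (eps : 'I_n -> {RV P >-> R}) (sigma2 : R)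
    (A : 'M[R]_n) :
    mutually_independent eps ->
    (forall i, 'E_P[eps i] = 0) -> (forall i, 'V_P[eps i] = sigma2%:E) ->
  'E_P[fun w => dotmx (\col_i eps i w) (A *m \col_i eps i w)] =
    (sigma2 * \tr A)%:E.
Proof.
move=> eps_indep eps0 epsV.
have L2 i : (eps i : T -> R) \in Lfun P 2%:E.
  by apply: variance_fin_Lfun2; rewrite ?epsV.
have L1 i : (eps i : T -> R) \in Lfun P 1.
  by apply: Lfun_subset12 => //; exact: fin_num_measure.
have Lmul i j := Lfun2_mul_Lfun1 (L2 i) (L2 j).
have Emul i j : 'E_P[eps i \* eps j] = if i == j then sigma2%:E else 0.
  case: eqVneq => [<-|ij].
    have := varianceE (L2 i).
    by rewrite epsV eps0 expe2 mul0e sube0 => ->.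
  rewrite expectationM_indep// ?eps0 ?mule0// => B C mB mC.
  (* Pairwise independence is mutual independence for the index set {i, j}, with event [B] at [i]
     and [C] at [j]. *)
  have := eps_indep [set i; j]%SET (fun k => if k == i then B else C).
  rewrite big_setU1 ?inE//= big_set1 eqxx eq_sym (negbTE ij) => <-; last first.
    by move=> k; case: ifP.
  congr (P _); apply/seteqP; split => w /=.
    by move=> [Bw Cw] k /=; rewrite !inE => /orP[]/eqP->;
      rewrite ?eqxx// eq_sym (negbTE ij).
  move=> h; split; first by have := h i; rewrite /= !inE eqxx; exact.
  by have := h j; rewrite /= !inE eqxx orbT eq_sym (negbTE ij); exact.
pose F (ij : 'I_n * 'I_n) := (A ij.1 ij.2 \o* (eps ij.1 \* eps ij.2))%R.
have -> : (fun w => dotmx (\col_i eps i w) (A *m \col_i eps i w)) =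
    (\sum_(f <- [seq F ij | ij <- index_enum ('I_n * 'I_n)%type]) f)%R.
  apply/funext => w; rewrite quadratic_formE pair_bigA/= big_map fct_sumE.
  by apply: eq_bigr => -[i j] _ /=; rewrite !mxE mulrC.
rewrite expectation_sum => [|f /mapP[ij _ ->]]; last by rewrite Lfun_scale.
rewrite big_map (eq_bigr (fun ij : 'I_n * 'I_n =>
  (A ij.1 ij.2 * (if ij.1 == ij.2 then sigma2 else 0))%:E)); last first.
  by move=> [i j] _; rewrite /F expectationZl// Emul EFinM; case: ifP.
rewrite sumEFin; congr EFin.
rewrite -(pair_bigA _ (fun i j => A i j * (if i == j then sigma2 else 0))%R)/=.
rewrite /mxtrace mulr_sumr; apply: eq_bigr => i _.
rewrite (bigD1 i)//= eqxx big1 ?addr0 1?mulrC// => j ji.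
by rewrite eq_sym (negbTE ji) mulr0.
Qed.

End Moments.

(** * Measurability and the tail bound at fixed sample size *)

Lemma measurable_quadratic_form (R : realType) d (T : measurableType d) n
    (V : T -> 'cV[R]_n) (A : 'M[R]_n) :
  random_vector V -> measurable_fun setT (fun w => dotmx (V w) (A *m V w)).
Proof.
move=> mV; under eq_fun do rewrite quadratic_formE.
apply: measurable_sum => i; apply: measurable_sum => j.
by apply: measurable_funM => //; exact: measurable_funM.
Qed.

Lemma measurable_norm2 (R : realType) d (T : measurableType d) n
    (V : T -> 'cV[R]_n) :
  random_vector V -> measurable_fun setT (fun w => norm2 (V w)).
Proof.
move=> mV; rewrite /norm2.
apply: (@measurableT_comp _ _ _ _ _ _ (@Num.sqrt R)).
  by apply: continuous_measurable_fun; exact: sqrt_continuous.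
by apply: measurable_sum => i; exact: measurable_funX.
Qed.

(** Once the penalty term is at most e^2 / 2, an error above [e] forces the noise term of the
    deterministic bound above e^2 / 2; Markov's inequality controls that event. *)
Lemma ls_scad_tail_le (R : realType) d (T : measurableType d)
    (P : probability T R) (n p k : nat) (a sigma lambda rho e : R)
    (X : 'M[R]_(n, p)) (beta : 'cV[R]_p) (eps : 'I_n -> {RV P >-> R})
    (Y : T -> 'cV[R]_n) (bhat : T -> 'cV[R]_p) :
    (0 < n)%N -> 2 < a -> 0 < lambda -> 0 < rho -> 0 < e ->
    (forall j : 'I_p, (k <= j)%N -> beta j 0 = 0) ->
    (forall w i, Y w i 0 = (X *m beta) i 0 + eps i w) ->
    random_vector bhat -> (forall w, ls_scad X (Y w) lambda a (bhat w)) ->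
    smallest_eigenvalue (gram X) rho ->
    mutually_independent eps -> (forall i, 'E_P[eps i] = 0)%E ->
    (forall i, 'V_P[eps i] = (sigma ^+ 2)%:E)%E ->
    (a + 1) * (k%:R * lambda ^+ 2 / rho) <= e ^+ 2 / 2 ->
  (P [set w | (e < `|norm2 (bhat w - beta) - 0|)%R] <=
    (8 * sigma ^+ 2 / e ^+ 2 * (p%:R / (n%:R * rho)))%:E)%E.
Proof.
move=> n0 a2 l0 rho0 e0 beta0 model mbhat lsbhat srho eps_indep eps0 epsV pen.
have nR : 0 < n%:R :> R by rewrite ltr0n.
have uG := smallest_eigenvalue_gt0_unit srho rho0.
pose E w : 'cV[R]_n := \col_i eps i w.
have YE w : Y w = X *m beta + E w by apply/colP => i; rewrite model !mxE.
pose Z w := dotmx (E w) (hat_mx X *m E w).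
have Z0 w : 0 <= Z w by exact: dotmx_hat_mx_ge0.
have mZ : measurable_fun setT Z.
  apply: measurable_quadratic_form => i; under eq_fun do rewrite mxE.
  exact: measurable_funPT.
have EZ : (\int[P]_w (Z w)%:E)%E = (sigma ^+ 2 * p%:R)%:E.
  by rewrite -(mxtrace_hat_mx uG) -(expectation_quadratic_form _ eps_indep)// unlock.
(* The threshold solves 4 c / (n rho) = e^2 / 2. *)
pose c := e ^+ 2 * (n%:R * rho) / 8.
have c0 : 0 < c by rewrite divr_gt0 ?mulr_gt0 ?exprn_gt0.
apply: (@le_trans _ _ (P [set w | (c%:E <= `|(Z w)%:E|)%E])).
  (* Monotonicity is applied to measurable events; measurability of [bhat] enters here. *)
  apply: le_measure; rewrite ?inE.
  - rewrite -[X in measurable X]setTI.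
    apply: (measurable_fun_ltr (f := cst e)) => //.
    apply: measurableT_comp => //; apply: measurable_funB => //.
    apply: measurable_norm2 => j; under eq_fun do rewrite !mxE.
    by apply: measurable_funD => //; exact: mbhat.
  - rewrite -[X in measurable X]setTI; apply: emeasurable_fun_c_infty => //.
    by apply: measurableT_comp => //; exact/measurable_EFinP.
  - move=> w /=; rewrite subr0 lee_fin ger0_norm ?sqrtr_ge0// ger0_norm// => elt.
    have := ls_scad_error_le n0 l0 a2 beta0 srho rho0 (YE w) (lsbhat w).
    have : e ^+ 2 < norm2 (bhat w - beta) ^+ 2.
      by rewrite ltr_pXn2r// nnegrE ?sqrtr_ge0// ltW.
    rewrite -/(Z w) => lt le.
    have : e ^+ 2 / 2 <= 4 / (n%:R * rho) * Z w by lra.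
    rewrite [leRHS]mulrAC ler_pdivlMr ?mulr_gt0// /c; lra.
have markovZ : (c%:E * P [set w | c%:E <= `|(Z w)%:E|] <=
    (sigma ^+ 2 * p%:R)%:E)%E.
  have mEZ : measurable_fun setT (EFin \o Z) by exact/measurable_EFinP.
  have := le_integral_abse P measurableT mEZ c0; rewrite setTI -EZ.
  by under [X in (_ <= X)%E -> _]eq_integral do rewrite /= ger0_norm//.
rewrite -(@lee_pmul2l _ c%:E)// (le_trans markovZ)//.
rewrite -EFinM lee_fin le_eqVlt; apply/orP; left; apply/eqP.
by rewrite /c; field; rewrite !gt_eqF.
Qed.

(** * Passage to the limit *)

Theorem theorem1
  (R : realType)
  (a sigma : R)
  (errlaw : probability (measurableTypeR R) R)
  (d : nat -> measure_display)
  (T : forall n, measurableType (d n))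
  (P : forall n, probability (T n) R)
  (p k : nat -> nat)
  (lambda rho : nat -> R)
  (X : forall n, 'M[R]_(n, p n))
  (beta : forall n, 'cV[R]_(p n))
  (eps : forall n, 'I_n -> {RV (P n) >-> R})
  (Y : forall n, T n -> 'cV[R]_n)
  (bhat : forall n, T n -> 'cV[R]_(p n))
  (ha : 2 < a)
  (hlambda : forall n, (0 < n)%N -> 0 < lambda n)
  (hkp : forall n, (0 < n)%N -> (k n <= p n)%N)
  (hbeta1 : forall n, (0 < n)%N ->
    forall j : 'I_(p n), (j < k n)%N -> beta n j 0 != 0)
  (hbeta2 : forall n, (0 < n)%N ->
    forall j : 'I_(p n), (k n <= j)%N -> beta n j 0 = 0)
  (hmodel : forall n, (0 < n)%N -> forall (w : T n) (i : 'I_n),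
    Y n w i 0 = (X n *m beta n) i 0 + eps n i w)
  (hbhat_meas : forall n, (0 < n)%N -> random_vector (bhat n))
  (hbhat : forall n, (0 < n)%N -> forall w : T n,
    ls_scad (X n) (Y n w) (lambda n) a (bhat n w))
  (hrho : forall n, (0 < n)%N -> smallest_eigenvalue (gram (X n)) (rho n))
  (hrho_pos : \forall n \near \oo, 0 < rho n)
  (heps_indep : forall n, (0 < n)%N -> mutually_independent (eps n))
  (heps_law : forall n, (0 < n)%N -> forall i : 'I_n, has_law (eps n i) errlaw)
  (heps_mean : forall n, (0 < n)%N -> forall i : 'I_n,
    'E_(P n)[eps n i]%E = 0%E)
  (heps_var : forall n, (0 < n)%N -> forall i : 'I_n,
    'V_(P n)[eps n i]%E = (sigma ^+ 2)%:E)
  (hcol : forall n, (0 < n)%N -> forall j : 'I_(p n),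
    norm2 (col j (X n)) ^+ 2 = n%:R)
  (hlim3 : (fun n => Num.sqrt (k n)%:R * lambda n / Num.sqrt (rho n))
    @ \oo --> (0 : R))
  (hlim4 : (fun n => Num.sqrt (p n)%:R / Num.sqrt (n%:R * rho n))
    @ \oo --> (0 : R)) :
  cvg_in_probability P (fun n w => norm2 (bhat n w - beta n)) 0.
Proof.
move=> e e0.
have k_lim : (k n)%:R * lambda n ^+ 2 / rho n @[n --> \oo] --> (0 : R).
  rewrite -(mulr0 0); apply: cvg_trans (cvgM hlim3 hlim3).
  (* Squaring the assumed limit removes the square roots only where [rho n] is nonnegative, so the
     two sequences are compared for large [n]. *)
  apply: near_eq_cvg; near=> n; have rho0 : 0 < rho n by near: n.
  by rewrite /= -expr2 !exprMn exprVn !sqr_sqrtr ?ler0n// ltW.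
have p_lim : (p n)%:R / (n%:R * rho n) @[n --> \oo] --> (0 : R).
  rewrite -(mulr0 0); apply: cvg_trans (cvgM hlim4 hlim4).
  apply: near_eq_cvg; near=> n; have rho0 : 0 < rho n by near: n.
  by rewrite /= -expr2 exprMn exprVn !sqr_sqrtr ?mulr_ge0 ?ler0n// ltW.
have pen : \forall n \near \oo,
    (a + 1) * ((k n)%:R * lambda n ^+ 2 / rho n) <= e ^+ 2 / 2.
  have d0 : 0 < e ^+ 2 / 2 / (a + 1) by rewrite !divr_gt0 ?exprn_gt0//; lra.
  move/cvgr0Pnorm_le : k_lim => /(_ _ d0); apply: filterS => n.
  rewrite ler_pdivlMr; last by lra.
  by rewrite mulrC; apply: le_trans; rewrite ler_wpM2l ?ler_norm//; lra.
pose C := 8 * sigma ^+ 2 / e ^+ 2.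
(* The tail probability lies eventually between 0 and a constant multiple of p / (n rho). *)
apply: (@squeeze_cvge _ _ _ _ (cst 0%E) _
  (fun n => (C * ((p n)%:R / (n%:R * rho n)))%:E)).
- near=> n.
  have n0 : (0 < n)%N by near: n; exact: nbhs_infty_gt.
  rewrite measure_ge0/=.
  apply: (@ls_scad_tail_le _ _ _ _ _ _ (k n) a _ (lambda n) _ _ (X n) (beta n)
    (@eps n) (@Y n)) => //.
  + exact: hlambda.
  + by near: n.
  + exact: hbeta2.
  + exact: hmodel.
  + exact: hbhat_meas.
  + exact: hbhat.
  + exact: hrho.
  + exact: heps_indep.
  + exact: heps_mean.
  + exact: heps_var.
  + by near: n.
- exact: cvg_cst.
- apply: cvg_EFin; first by near=> n.
  rewrite -(mulr0 C).
  by apply: cvgM => //; exact: cvg_cst.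
Unshelve. all: by end_near. Qed.
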